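(* Let $\mathcal{X}\subset\mathbb{R}^n$, let $\mathcal{X}_N$ be an $\varepsilon_0$-net of $\mathcal{X}$, let $L>0$, and let $\mathscr{S}$ be a subset of the finite sensor set $\mathscr{M}$ satisfying $$\forall\,\mathbf{x}_i,\mathbf{x}_j\in\mathcal{X}_N:\qquad\Vert\mathbf{g}(\mathbf{x}_i)-\mathbf{g}(\mathbf{x}_j)\Vert_2\leq L\Vert\mathbf{m}_{\mathscr{S}}(\mathbf{x}_i)-\mathbf{m}_{\mathscr{S}}(\mathbf{x}_j)\Vert_2.$$ If $\mathbf{m}_{\mathscr{S}}$ and $\mathbf{g}$ are Lipschitz functions, with Lipschitz constants $\Vert\mathbf{m}_{\mathscr{S}}\Vert_{\mathrm{lip}}$ and $\Vert\mathbf{g}\Vert_{\mathrm{lip}}$ respectively, then $$\forall\,\mathbf{x},\mathbf{x}'\in\mathcal{X}:\qquad\Vert\mathbf{g}(\mathbf{x})-\mathbf{g}(\mathbf{x}')\Vert_2<L\Vert\mathbf{m}_{\mathscr{S}}(\mathbf{x})-\mathbf{m}_{\mathscr{S}}(\mathbf{x}')\Vert_2+2\left(\Vert\mathbf{g}\Vert_{\mathrm{lip}}+L\Vert\mathbf{m}_{\mathscr{S}}\Vert_{\mathrm{lip}}\right)\varepsilon_0.$$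
   Context: The target function is $\mathbf{g}:\mathcal{X}\to\mathbb{R}^q$ and the sensors are functions $\mathbf{m}_j:\mathcal{X}\to\mathbb{R}^{d_j}$, $j\in\mathscr{M}$. For $\mathscr{S}=\{j_1,\dots,j_K\}\subseteq\mathscr{M}$, $\mathbf{m}_{\mathscr{S}}(\mathbf{x})=(\mathbf{m}_{j_1}(\mathbf{x}),\dots,\mathbf{m}_{j_K}(\mathbf{x}))$ is the concatenated measurement. An $\varepsilon_0$-net of $\mathcal{X}$ is a finite subset $\mathcal{X}_N\subset\mathcal{X}$ such that for every $\mathbf{x}\in\mathcal{X}$ there is $\mathbf{x}_i\in\mathcal{X}_N$ with $\Vert\mathbf{x}-\mathbf{x}_i\Vert_2<\varepsilon_0$. Lipschitz constants are with respect to Euclidean norms. $L$ is a user-specified threshold for the Lipschitz constant of the reconstruction function.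
   Formalization: The Lipschitz constants of g and m_S are assumed not both zero: if both are zero, g and m_S are constant on X and the strict inequality reads 0 < 0 for every nonempty X. *)

(* Defs.v *)
From mathcomp Require Import all_boot all_order all_algebra.
From mathcomp Require Import all_classical all_reals.

Set Implicit Arguments.
Unset Strict Implicit.
Unset Printing Implicit Defensive.

Import Order.TTheory GRing.Theory Num.Theory.

Local Open Scope classical_set_scope.
Local Open Scope ring_scope.

(* The library's norm `|v| on row vectors is the sup norm, hence this definition. *)
Definition norm2 (R : realType) (k : nat) (v : 'rV[R]_k) : R :=
  Num.sqrt (\sum_(i < k) v ord0 i ^+ 2).

Definition is_net (R : realType) (n : nat) (e : R) (X XN : set 'rV[R]_n) : Prop :=
  [/\ finite_set XN, XN `<=` X &
      forall x, X x -> exists2 xi, XN xi & norm2 (x - xi) < e].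

(* K is any Lipschitz constant of f on X, not necessarily the least one.
   Nonnegativity matters only when X has at most one point. *)
Definition lipschitz_const (R : realType) (n k : nat) (X : set 'rV[R]_n)
    (f : 'rV[R]_n -> 'rV[R]_k) (K : R) : Prop :=
  0 <= K /\
  forall x y, X x -> X y -> norm2 (f x - f y) <= K * norm2 (x - y).

(* The sensors j_1, ..., j_K of S are taken in the order of [enum S]. *)
Definition concat_meas (R : realType) (n : nat) (M : finType) (d : M -> nat)
    (m : forall j : M, 'rV[R]_n -> 'rV[R]_(d j)) (S : {set M}) (x : 'rV[R]_n) :
    'rV[R]_(\sum_(k < #|S|) d (enum_val k)) :=
  \mxrow_(k < #|S|) m (enum_val k) x.

(* Main.v *)
Require Import Defs.
From mathcomp Require Import all_boot all_order all_algebra.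
From mathcomp Require Import all_classical all_reals.
From mathcomp Require Import ring lra.

(** The proof is two detours through the net.  Choose net points [xi], [xj]
    closer than [e0] to [x], [x'].  The triangle inequality for [norm2] bounds
    [norm2 (g x - g x')] by the distance between [g xi] and [g xj] plus two
    errors, each less than or equal to [lip_g] times a net distance.  The
    hypothesis on the net passes from [g] to the measurements, and a second
    detour, from [xi], [xj] back to [x], [x'], costs [L * lip_m] times the same
    two net distances.  The total error is [lip_g + L * lip_m] times the sum of
    the two net distances; this sum is strictly below [2 * e0], and the positive
    factor preserves strictness.

    The triangle inequality itself ([norm2D]) rests on Cauchy-Schwarz
    ([dot_le_norm2]). *)

Import Order.TTheory GRing.Theory Num.Theory.

Local Open Scope classical_set_scope.
Local Open Scope ring_scope.

Section EuclideanNorm.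
Variables (R : realType) (k : nat).
Implicit Types u v w : 'rV[R]_k.

Lemma norm2_ge0 u : 0 <= norm2 u.
Proof. exact: sqrtr_ge0. Qed.

Lemma sqr_norm2 u : norm2 u ^+ 2 = \sum_(i < k) u ord0 i ^+ 2.
Proof. by rewrite sqr_sqrtr // sumr_ge0 // => i _; exact: sqr_ge0. Qed.

Lemma norm2_eq0 u i : norm2 u = 0 -> u ord0 i = 0.
Proof.
move=> u0; apply/eqP; rewrite -sqrf_eq0.
have /eqP := sqr_norm2 u; rewrite u0 expr0n /= eq_sym psumr_eq0.
  by move=> /allP/(_ i); rewrite mem_index_enum => /(_ isT).
by move=> j _; exact: sqr_ge0.
Qed.

Lemma norm2_distC u v : norm2 (u - v) = norm2 (v - u).
Proof.
by rewrite /norm2; congr Num.sqrt; apply: eq_bigr => i _; rewrite !mxE; ring.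
Qed.

(** Cauchy-Schwarz.  With [a], [b] the norms of [u], [v], the vector
    [b u - a v] has squared norm [2ab (ab - <u, v>)], which is nonnegative;
    dividing by [2ab] requires both norms to be nonzero. *)
Lemma dot_le_norm2 u v :
  \sum_(i < k) u ord0 i * v ord0 i <= norm2 u * norm2 v.
Proof.
have [u0|u_neq0] := eqVneq (norm2 u) 0.
  by rewrite u0 mul0r big1 // => i _; rewrite (norm2_eq0 _ _ u0) mul0r.
have [v0|v_neq0] := eqVneq (norm2 v) 0.
  by rewrite v0 mulr0 big1 // => i _; rewrite (norm2_eq0 _ _ v0) mulr0.
have a_gt0 : 0 < norm2 u by rewrite lt_def u_neq0 norm2_ge0.
have b_gt0 : 0 < norm2 v by rewrite lt_def v_neq0 norm2_ge0.
set a := norm2 u in a_gt0 *; set b := norm2 v in b_gt0 *.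
set dot := \sum_(i < k) _.
have expand : \sum_(i < k) (b * u ord0 i - a * v ord0 i) ^+ 2 =
    2 * (a * b) * (a * b - dot).
  transitivity (b ^+ 2 * a ^+ 2 - 2 * (a * b) * dot + a ^+ 2 * b ^+ 2).
    have a2 : a ^+ 2 = _ := sqr_norm2 u; have b2 : b ^+ 2 = _ := sqr_norm2 v.
    rewrite {1}a2 {2}b2 /dot !mulr_sumr -sumrB -big_split /=.
    by apply: eq_bigr => i _; ring.
  by ring.
have : 0 <= 2 * (a * b) * (a * b - dot).
  by rewrite -expand sumr_ge0 // => i _; exact: sqr_ge0.
by rewrite pmulr_rge0 ?subr_ge0 // !mulr_gt0.
Qed.

Lemma norm2D u v : norm2 (u + v) <= norm2 u + norm2 v.
Proof.
rewrite -(@ler_pXn2r _ 2) ?nnegrE ?addr_ge0 ?norm2_ge0 //.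
have -> : norm2 (u + v) ^+ 2 =
    norm2 u ^+ 2 + 2 * (\sum_(i < k) u ord0 i * v ord0 i) + norm2 v ^+ 2.
  rewrite !sqr_norm2 mulr_sumr -!big_split /=.
  by apply: eq_bigr => i _; rewrite mxE; ring.
have := dot_le_norm2 u v; nra.
Qed.

Lemma norm2_dist_triangle w u v : norm2 (u - v) <= norm2 (u - w) + norm2 (w - v).
Proof. by rewrite -[u - v](subrKA w) norm2D. Qed.

(** The two detours of the main proof are instances of this bound, used in
    opposite directions: from points to their net neighbours for [g], and from
    net neighbours back to the points for the measurements. *)
Lemma norm2_dist_detour u' v' u v :
  norm2 (u - v) <= norm2 (u - u') + norm2 (u' - v') + norm2 (v - v').
Proof.
have := norm2_dist_triangle u' u v; have := norm2_dist_triangle v' u' v.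
rewrite (norm2_distC v' v); lra.
Qed.

End EuclideanNorm.

Theorem proposition4p6 (R : realType) (n q : nat) (M : finType) (d : M -> nat)
    (X XN : set 'rV[R]_n)
    (g : 'rV[R]_n -> 'rV[R]_q)
    (m : forall j : M, 'rV[R]_n -> 'rV[R]_(d j))
    (e0 L : R) (S : {set M}) (lip_m lip_g : R)
    (net : is_net e0 X XN)
    (L_gt0 : 0 < L)
    (sep : forall xi xj, XN xi -> XN xj ->
      norm2 (g xi - g xj) <= L * norm2 (concat_meas m S xi - concat_meas m S xj))
    (m_lip : lipschitz_const X (concat_meas m S) lip_m)
    (g_lip : lipschitz_const X g lip_g)
    (* not both constants vanish: otherwise the strict inequality reads 0 < 0 *)
    (lip_gt0 : 0 < lip_g + L * lip_m) :
  forall x x', X x -> X x' ->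
    norm2 (g x - g x') <
      L * norm2 (concat_meas m S x - concat_meas m S x')
      + 2 * (lip_g + L * lip_m) * e0.
Proof.
move=> x x' Xx Xx'; case: net => _ XNX cover.
have [xi XNi dxi] := cover x Xx; have [xj XNj dxj] := cover x' Xx'.
have Xi := XNX _ XNi; have Xj := XNX _ XNj.
case: m_lip => _ m_lip; case: g_lip => _ g_lip.
set f := concat_meas m S in sep m_lip *.
have g_detour := norm2_dist_detour _ _ (g xi) (g xj) (g x) (g x').
have g_net := sep _ _ XNi XNj.
have f_detour : L * norm2 (f xi - f xj) <=
    L * (lip_m * norm2 (x - xi) + norm2 (f x - f x') + lip_m * norm2 (x' - xj)).
  rewrite ler_pM2l //; apply: le_trans (norm2_dist_detour _ _ (f x) (f x') _ _) _.
  rewrite (norm2_distC _ _ (f xi)) (norm2_distC _ _ (f xj)).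
  by rewrite !lerD // m_lip.
have g_i := g_lip _ _ Xx Xi; have g_j := g_lip _ _ Xx' Xj.
have net_err : (lip_g + L * lip_m) * (norm2 (x - xi) + norm2 (x' - xj)) <
    (lip_g + L * lip_m) * (e0 + e0).
  by rewrite ltr_pM2l // ltrD.
lra.
Qed.
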